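(* The following hold. (a) If $S = \langle a_1,\ldots,a_k\rangle$ is a numerical semigroup with $k \ge 2$ minimal generators that has a minimal presentation $\rho$ in which every trade is between factorizations with singleton support, then $\Delta_0(S) = \{1\}$. In particular, this occurs whenever $S$ is supersymmetric or generated by a geometric sequence. (b) If $S = \langle m, a_1, \ldots, a_{m-1}\rangle$ is a numerical semigroup with $m \ge 3$ and each $a_i \equiv i \bmod m$, where $m$ is the smallest positive element of $S$ and $m, a_1, \ldots, a_{m-1}$ are the minimal generators of $S$ (i.e., $S$ is maximal embedding dimension), then $\Delta_0(S) = \{1,2\}$. (c) If $S = \langle a, ah + d, ah + 2d,\ldots, ah + kd\rangle$ with $a, d, h, k$ positive integers, $h \ge 1$, $2 \le k < a$, and $\gcd(a,d) = 1$ (i.e., $S$ is generated by a generalized arithmetic sequence), then $\Delta_0(S) = \{1,2\}$.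
   Context: A numerical semigroup is a cofinite, additively closed subset $S \subseteq \mathbb{Z}_{\ge 0}$ containing $0$; $\langle b_1,\ldots,b_n\rangle$ denotes the set of all $\mathbb{Z}_{\ge 0}$-linear combinations of $b_1,\ldots,b_n$. Let $S$ have minimal generators $b_1,\ldots,b_n$. For $x \in S$, $\mathsf Z(x) = \{z \in \mathbb{Z}_{\ge 0}^n : x = z_1b_1 + \cdots + z_nb_n\}$ is its set of factorizations. The support of $z$ is $\operatorname{supp}(z) = \{i : z_i > 0\}$ and $\ell_0(z) = |\operatorname{supp}(z)|$. Set $\mathcal L_0(x) = \{\ell_0(z) : z \in \mathsf Z(x)\} = \{c_1 < \cdots < c_r\}$, $\Delta_0(x) = \{c_i - c_{i-1} : i = 2,\ldots,r\}$, and $\Delta_0(S) = \bigcup_{x \in S}\Delta_0(x)$. A trade of $S$ is a relation $z \sim z'$ between two factorizations $z, z'$ of the same element of $S$ having disjoint supports; it is sometimes identified with $z - z' \in \mathbb{Z}^n$. A presentation of $S$ is a collection $\rho$ of trades such that for any $x \in S$ and $z, z' \in \mathsf Z(x)$ there is a chain $z = y_1, y_2, \ldots, y_r = z'$ of factorizations of $x$ with $y_i - y_{i-1} \in \rho$ or $y_{i-1} - y_i \in \rho$ for each $i$; it is minimal if it is minimal under containment among presentations of $S$. $S$ is supersymmetric if its minimal generators are $T/p_1,\ldots,T/p_n$ where $p_1,\ldots,p_n$ are pairwise coprime positive integers and $T = p_1\cdots p_n$. $S$ is generated by a geometric sequence if its minimal generators are $a^{n-i}b^{i-1}$, $i=1,\ldots,n$,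 for some coprime positive integers $a < b$. *)

(* Defs.v *)
From mathcomp Require Import all_boot all_order all_algebra.
From mathcomp Require Import classical_sets cardinality.

Set Implicit Arguments.
Unset Strict Implicit.
Unset Printing Implicit Defensive.

Local Open Scope classical_set_scope.

Definition numerical_semigroup (S : set nat) : Prop :=
  [/\ S 0, forall x y, S x -> S y -> S (x + y) & finite_set (~` S)].

Notation factorization n := {ffun 'I_n -> nat}.

Definition value n (b : 'I_n -> nat) (z : factorization n) : nat :=
  \sum_(i < n) z i * b i.

Definition supp n (z : factorization n) : {set 'I_n} := [set i | 0 < z i]%SET.

Definition ell0 n (z : factorization n) : nat := #|supp z|.

Definition Z_ n (b : 'I_n -> nat) (x : nat) : set (factorization n) :=
  [set z | x = value b z].

Definition generated n (b : 'I_n -> nat) : set nat :=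
  [set x | exists z, Z_ b x z].

Definition generated_by n (b : 'I_n -> nat) (A : {set 'I_n}) : set nat :=
  [set x | exists2 z, Z_ b x z & supp z \subset A].

(* Minimality is over subfamilies, so a minimal b is automatically injective
   with positive values. *)
Definition minimal_generators (S : set nat) n (b : 'I_n -> nat) : Prop :=
  generated b = S /\
  forall A : {set 'I_n}, A \proper 'I_n -> generated_by b A <> S.

Definition L0 n (b : 'I_n -> nat) (x : nat) : set nat := [set ell0 z | z in Z_ b x].

Definition Delta0_elt n (b : 'I_n -> nat) (x : nat) : set nat :=
  [set d | exists c c', [/\ L0 b x c, L0 b x c', c < c',
     (forall e, L0 b x e -> ~~ (c < e < c')) & d = c' - c]].

(* The minimal generating family of S is unique up to reordering, on which
   Delta0_elt does not depend. *)
Definition Delta0 (S : set nat) : set nat :=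
  [set d | exists n (b : 'I_n -> nat),
     minimal_generators S b /\ (\bigcup_(x in S) Delta0_elt b x) d].

Definition is_trade n (b : 'I_n -> nat) (t : factorization n * factorization n) : Prop :=
  value b t.1 = value b t.2 /\ [disjoint supp t.1 & supp t.2]%bool.

(* y - y' is the integer vector t.1 - t.2 *)
Definition diff_trade n (t : factorization n * factorization n)
    (y y' : factorization n) : Prop :=
  forall i, ((y i)%:Z - (y' i)%:Z = (t.1 i)%:Z - (t.2 i)%:Z)%R.

Definition presentation n (b : 'I_n -> nat)
    (rho : set (factorization n * factorization n)) : Prop :=
  (forall t, rho t -> is_trade b t) /\
  forall x z z', Z_ b x z -> Z_ b x z' ->
    exists (r : nat) (y : nat -> factorization n),
      [/\ y 0 = z, y r = z',
          forall i, i <= r -> Z_ b x (y i) &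
          forall i, i < r -> exists2 t, rho t &
            diff_trade t (y i.+1) (y i) \/ diff_trade t (y i) (y i.+1)].

Definition minimal_presentation n (b : 'I_n -> nat)
    (rho : set (factorization n * factorization n)) : Prop :=
  presentation b rho /\
  forall rho', rho' `<=` rho -> presentation b rho' -> rho' = rho.

Definition has_singleton_presentation n (b : 'I_n -> nat) : Prop :=
  exists rho, minimal_presentation b rho /\
    forall t, rho t -> ell0 t.1 = 1 /\ ell0 t.2 = 1.

Definition supersymmetric (S : set nat) : Prop :=
  exists n (p : 'I_n -> nat),
    [/\ forall i, 0 < p i,
        forall i j, i != j -> coprime (p i) (p j) &
        minimal_generators S (fun i => (\prod_(j < n) p j) %/ p i)].

Definition geometric (S : set nat) : Prop :=
  exists n a b,
    [/\ 0 < a, a < b, coprime a b &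
        minimal_generators S (fun i : 'I_n => a ^ (n - i.+1) * b ^ i)].

(* Main.v *)
Require Import Defs.
From mathcomp Require Import all_boot all_order all_algebra.
From mathcomp Require Import classical_sets cardinality.
From mathcomp Require Import boolp zify.
From Stdlib Require Import Relation_Operators.

Set Implicit Arguments.
Unset Strict Implicit.
Unset Printing Implicit Defensive.

Import GRing.Theory.
Local Open Scope classical_set_scope.

(** Consider exchanges w + u -> w + v, where u and v have the same value and
supports of size at most s.  Since |supp w| <= |supp (w + u)| <= |supp w| + s
and likewise for v, an exchange changes the support size by at most s, so a
chain of exchanges joining two factorizations cannot jump over a gap of L0
longer than s ([linked_gap]).  Upper bounds on Delta0 thus come from connecting factorizations by exchanges of
small support: s = 1 when all trades of a presentation have singleton supports,
s = 2 in the two other families.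

The value 1 always occurs, in the element 2 b_i b_j, which is 2 b_j copies of
b_i and also b_j copies of b_i with b_i copies of b_j.  For the value 2, take a
factorization z in which all n generators occur and which is not alone in its
fiber.  A factorization u of the same value with exactly n - 1 generators,
say all but b_j, dominates the indicator of the indices other than j; removing
this indicator from z and u leaves an equality in which b_j is not used on the
side of u.  If z is the sum of all generators, the side of z is then b_j
itself, which contradicts minimality; in the arithmetic case z contains the
first generator h times, and [arith_rigid] takes the place of minimality.  Hence
L0 contains n but not n - 1, and the gap below n has length at least 2, hence
exactly 2 by the upper bound ([Delta0_of_exchange2]).

Supersymmetric and geometric generators share the triangular pattern of
[triangular_linked]: the congruence class of z_j modulo alpha_j is determined by
the value and the earlier coordinates, so the surplus of z_j over z'_j is a
multiple of alpha_j and can be traded into the next coordinate.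

For maximal embedding dimension and for generalized arithmetic sequences the
connection is made by descent ([linked_by_descent]): it is enough to reach, from
each of two factorizations, one that uses a fixed generator, which is then
cancelled.  In maximal embedding dimension any two generators other than m trade
for a factorization that uses m.  In the arithmetic case the trades
b_i + b_j ~ h a + b_(i+j), when i + j <= k, and b_i + b_j ~ b_(i+j-k) + b_k, when
i + j > k, with b_i = a h + i d, bring a nonzero factorization either to one that
uses a or to b_r + q b_k; if the weight r + q k reaches the modulus a, one more
trade produces copies of a, and otherwise the value determines r and q
([arith_normal_rigid]). *)

(** * Factorizations and exchanges *)

Section Factorizations.
Variable n : nat.
Implicit Types (b : 'I_n -> nat) (z w u v : factorization n) (i j : 'I_n).

Definition single i c : factorization n := [ffun j => if j == i then c else 0].

(** The generic extensionality of finite functions leaves applications that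
linear arithmetic does not identify with the ones written here. *)
Lemma eqz z w : (forall i, z i = w i) -> z = w.
Proof. by move=> e; apply/ffunP. Qed.

Lemma addzE z w i : (z + w)%R i = z i + w i.
Proof. by rewrite ffunE. Qed.

Lemma zero_zE i : (0 : factorization n)%R i = 0.
Proof. by rewrite ffunE. Qed.

Lemma singleE i c j : single i c j = if j == i then c else 0.
Proof. by rewrite ffunE. Qed.

Lemma valueD b z w : value b (z + w)%R = value b z + value b w.
Proof.
rewrite /value -big_split; apply: eq_bigr => i _ /=.
by rewrite addzE mulnDl.
Qed.

Lemma value0 b : value b (0 : factorization n)%R = 0.
Proof. by apply: big1 => i _; rewrite zero_zE. Qed.

Lemma value_single b i c : value b (single i c) = c * b i.
Proof.
rewrite /value (bigD1 i) //= singleE eqxx big1 ?addn0 // => j /negPf nij.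
by rewrite singleE nij.
Qed.

Lemma single0 i : single i 0 = 0%R.
Proof. by apply: eqz => j; rewrite singleE zero_zE; case: ifP. Qed.

Lemma singleD i c d : single i (c + d) = (single i c + single i d)%R.
Proof. by apply: eqz => j; rewrite addzE !singleE; case: ifP. Qed.

Lemma single_le i c z : c <= z i -> exists w : factorization n, z = (single i c + w)%R.
Proof.
move=> cz; exists [ffun j => if j == i then z j - c else z j].
apply: eqz => j; rewrite addzE singleE ffunE; case: eqP => [->|_]; lia.
Qed.

Lemma factorization_ind (P : factorization n -> Prop) :
  P 0%R -> (forall i z, P z -> P (single i 1 + z)%R) -> forall z, P z.
Proof.
move=> P0 PD z; have [N] := ubnP (\sum_i z i).
elim: N z => // N IH z zN.
have [/existsP[i zi]|/existsPn z0] := boolP [exists i, 0 < z i].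
  have [w zE] := single_le zi; rewrite zE; apply: PD; apply: IH.
  move: zN; rewrite zE; under eq_bigr do rewrite addzE.
  rewrite big_split /= (bigD1 i) //= singleE eqxx; lia.
suff -> : z = 0%R by [].
by apply: eqz => i; rewrite zero_zE; have := z0 i; lia.
Qed.

Lemma generator_le_value b z i : 0 < z i -> b i <= value b z.
Proof.
move=> /single_le[w ->]; rewrite valueD value_single mul1n; exact: leq_addr.
Qed.

Lemma value_eq0 b z : (forall i, 0 < b i) -> value b z = 0 -> z = 0%R.
Proof.
move=> b_gt0 z0; apply: eqz => i; rewrite zero_zE.
have := @generator_le_value b z i; have := b_gt0 i; rewrite z0; lia.
Qed.

Lemma suppE z i : (i \in supp z) = (0 < z i).
Proof. by rewrite inE. Qed.

Lemma ell0_single i c : ell0 (single i c) = (0 < c).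
Proof.
rewrite /ell0; case: c => [|c] /=.
  by apply: eq_card0 => j; rewrite suppE singleE; case: ifP.
rewrite -(cards1 i); apply: eq_card => j.
by rewrite suppE singleE inE; case: eqP.
Qed.

Lemma suppD z w : supp (z + w)%R = (supp z :|: supp w)%SET.
Proof. by apply/setP => i; rewrite !inE addzE addn_gt0. Qed.

Lemma ell0D_ge z w : ell0 z <= ell0 (z + w)%R.
Proof. by rewrite /ell0 suppD subset_leq_card // finset.subsetUl. Qed.

Lemma ell0D_le z w : ell0 (z + w)%R <= ell0 z + ell0 w.
Proof. by rewrite /ell0 suppD cardsU leq_subr. Qed.

Implicit Type rho : set (factorization n * factorization n).

Definition exchange rho z z' : Prop :=
  exists2 t, rho t &
    exists w : factorization n, z = (w + t.1)%R /\ z' = (w + t.2)%R.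

Definition linked rho := clos_refl_sym_trans _ (exchange rho).

Definition small b s : set (factorization n * factorization n) :=
  [set t | [/\ value b t.1 = value b t.2, ell0 t.1 <= s & ell0 t.2 <= s]].

Lemma linked_refl rho z : linked rho z z. Proof. exact: rst_refl. Qed.

Lemma linked_sym rho z z' : linked rho z z' -> linked rho z' z.
Proof. exact: rst_sym. Qed.

Lemma linked_trans rho z y z' :
  linked rho z y -> linked rho y z' -> linked rho z z'.
Proof. exact: rst_trans. Qed.

Lemma linked_exchange rho t w : rho t -> linked rho (w + t.1)%R (w + t.2)%R.
Proof. by move=> rt; apply: rst_step; exists t => //; exists w. Qed.

Lemma linkedD rho w z z' : linked rho z z' -> linked rho (w + z)%R (w + z')%R.
Proof.
elim=> {z z'} [_ _ [t rt [u [-> ->]]]|z|z z' _|z y z' _ zy _ yz'].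
- by rewrite !addrA; apply: linked_exchange.
- exact: linked_refl.
- exact: linked_sym.
- exact: linked_trans zy yz'.
Qed.

Lemma linked_sub rho rho' z z' :
  rho `<=` rho' -> linked rho z z' -> linked rho' z z'.
Proof.
move=> sub; elim=> {z z'} [_ _ [t rt [u [-> ->]]]|z|z z' _|z y z' _ zy _ yz'].
- by apply: linked_exchange; apply: sub.
- exact: linked_refl.
- exact: linked_sym.
- exact: linked_trans zy yz'.
Qed.

Lemma linked_value b rho z z' :
  (forall t, rho t -> value b t.1 = value b t.2) ->
  linked rho z z' -> value b z = value b z'.
Proof.
move=> e; elim=> {z z'} [_ _ [t rt [u [-> ->]]]|z|z z' _|z y z' _ zy _ yz'] //.
  by rewrite !valueD (e _ rt).
by rewrite zy.
Qed.

Lemma exchange_ell0 b s z z' : exchange (small b s) z z' ->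
  ell0 z' <= ell0 z + s /\ ell0 z <= ell0 z' + s.
Proof.
case=> t [_ t1 t2] [w [-> ->]].
have := ell0D_le w t.1; have := ell0D_le w t.2.
have := ell0D_ge w t.1; have := ell0D_ge w t.2; lia.
Qed.

(** A chain starting at a factorization of support size c stays at sizes at most
c: a step climbs by at most s, hence cannot pass from c or below to c' > c + s,
and no size strictly between is available. *)
Lemma linked_gap b s x d :
  (forall z z', value b z = value b z' -> linked (small b s) z z') ->
  Delta0_elt b x d -> 0 < d <= s.
Proof.
move=> conn [c [c' [[z zx <-] [z' z'x <-] lt none ->]]].
rewrite subn_gt0 lt /= leqNgt; apply/negP => big.
have zz' : linked (small b s) z z' by apply: conn; rewrite -zx -z'x.
have vE y y' : linked (small b s) y y' -> value b y = value b y'.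
  by apply: linked_value => t [].
have step y y' : linked (small b s) y y' -> x = value b y ->
    (ell0 y <= ell0 z) = (ell0 y' <= ell0 z).
  elim=> {y y'} [y y' yy'|y|y y' yy' IH|y u y' yu IH uy' IH'] yx.
  - have y'x : x = value b y' by rewrite yx; apply: vE; apply: rst_step.
    have [] := exchange_ell0 yy'.
    have := none _ (ex_intro2 _ _ y yx erefl).
    have := none _ (ex_intro2 _ _ y' y'x erefl); lia.
  - by [].
  - by rewrite IH // yx (vE _ _ yy').
  - by rewrite IH // IH' // yx (vE _ _ yu).
have := step z z' zz' zx; lia.
Qed.

End Factorizations.

Lemma linked_small n (b : 'I_n -> nat) s w u v :
  value b u = value b v -> ell0 u <= s -> ell0 v <= s ->
  linked (small b s) (w + u)%R (w + v)%R.
Proof. by move=> uv us vs; apply: (linked_exchange (t := (u, v))). Qed.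

Lemma smallP n (b : 'I_n -> nat) s t : small b s t -> value b t.1 = value b t.2.
Proof. by case. Qed.

Lemma factorization_neq0 n (z : factorization n) :
  z <> 0%R -> exists i (w : factorization n), z = (single i 1 + w)%R.
Proof.
have [/existsP[i zi] _|/existsPn z0 []] := boolP [exists i, 0 < z i].
  by exists i; apply: single_le.
by apply: eqz => i; rewrite zero_zE; have := z0 i; lia.
Qed.

Lemma ell0_single_le n (i : 'I_n) c : ell0 (single i c) <= 1.
Proof. by rewrite ell0_single leq_b1. Qed.

Lemma ell0_two_le n (i j : 'I_n) c d : ell0 (single i c + single j d)%R <= 2.
Proof.
have := ell0D_le (single i c) (single j d).
have := ell0_single_le i c; have := ell0_single_le j d; lia.
Qed.

(** * Minimal generating families are unique up to reindexing *)

Lemma value_mulrn n (b : 'I_n -> nat) (z : factorization n) k :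
  value b (z *+ k)%R = k * value b z.
Proof. by elim: k => [|k IH]; rewrite ?mulr0n ?value0 // mulrS valueD IH mulSn. Qed.

Lemma mulrnzE n (z : factorization n) k i : (z *+ k)%R i = k * z i.
Proof. by elim: k => [|k IH]; rewrite ?mulr0n ?zero_zE // mulrS addzE IH mulSn. Qed.

(** If some factorization of b_i avoids i, substituting it for every copy of b_i
shows that the generators other than b_i suffice. *)
Lemma generator_needed (S : set nat) n (b : 'I_n -> nat) i z :
  minimal_generators S b -> value b z = b i -> 0 < z i.
Proof.
move=> [gen mini] zb; rewrite lt0n; apply/eqP => zi0.
apply: (mini [set~ i]%SET).
  by apply/properP; split; [apply/fintype.subsetP|exists i; rewrite ?inE ?eqxx].
rewrite -gen; apply/seteqP; split=> x [y yx]; first by exists y.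
have [w wE] : exists w : factorization n, y = (single i (y i) + w)%R.
  exact: single_le.
have wi : w i = 0.
  have /= := congr1 (fun f : factorization n => f i) wE.
  by rewrite addzE singleE eqxx; lia.
exists (z *+ y i + w)%R.
  rewrite /Z_ /= yx wE !valueD value_single value_mulrn zb addzE singleE.
  by rewrite eqxx wi addn0.
apply/fintype.subsetP => j; rewrite suppE addzE mulrnzE !inE.
by apply: contraTneq => ->; rewrite zi0 wi muln0.
Qed.

Lemma generator_gt0 (S : set nat) n (b : 'I_n -> nat) i :
  minimal_generators S b -> 0 < b i.
Proof.
move=> mg; rewrite lt0n; apply/eqP => bi0.
have := @generator_needed S n b i 0%R mg; rewrite value0 bi0 zero_zE.
by move=> /(_ erefl).
Qed.

Lemma generator_factorization_unique (S : set nat) n (b : 'I_n -> nat) i z :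
  minimal_generators S b -> value b z = b i -> z = single i 1.
Proof.
move=> mg zb; have [w zE] := single_le (generator_needed mg zb).
rewrite zE (@value_eq0 _ b w) ?addr0 // => [j|]; first exact: generator_gt0 mg.
by move: zb; rewrite zE valueD value_single; lia.
Qed.

Lemma minimal_generators_of_needed n (b : 'I_n -> nat) :
  (forall i z, value b z = b i -> 0 < z i) ->
  minimal_generators (generated b) b.
Proof.
move=> uniq; split=> // A /properP[_ [i _ iA]] AE.
have : generated_by b A (b i).
  rewrite AE; exists (single i 1); by rewrite /Z_ /= value_single mul1n.
move=> [z zb /fintype.subsetP zA]; move/negP: iA; apply; apply: zA.
by rewrite suppE uniq.
Qed.

Lemma generators_inj (S : set nat) n (b : 'I_n -> nat) :
  minimal_generators S b -> injective b.
Proof.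
move=> mg i j eb; have : single j 1 = single i 1.
  by apply: generator_factorization_unique mg _; rewrite value_single mul1n.
move/(congr1 (fun z : factorization n => z i)); rewrite /= !singleE eqxx.
by case: eqP.
Qed.

(** Writing a_i through b and then each b_j through a must give back the unique
factorization of a_i, so one of the b_j equals a_i. *)
Lemma generators_sub (S : set nat) n m (a : 'I_n -> nat) (b : 'I_m -> nat) :
  minimal_generators S a -> minimal_generators S b ->
  forall i, exists j, b j = a i.
Proof.
move=> mga mgb i.
have Sv z : S (value b z) by case: mgb => <- _; exists z.
have [z zx] : generated b (a i).
  case: mgb => -> _; case: mga => <- _; exists (single i 1).
  by rewrite /Z_ /= value_single mul1n.
have [j zj] : exists j, 0 < z j.
  apply/existsP; apply: contraT => /existsPn z0; have := generator_gt0 i mga.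
  suff -> : a i = 0 by [].
  rewrite zx -(value0 b); congr value; apply: eqz => j; rewrite zero_zE.
  by have := z0 j; lia.
have [w wE] := single_le zj.
have : S (b j) by have := Sv (single j 1); rewrite value_single mul1n.
have : S (value b w) by [].
have := mga.1 => <- [v vw] [y yb]; exists j.
have yv : (y + v)%R = single i 1.
  apply: generator_factorization_unique mga _.
  by rewrite valueD -yb -vw zx wE valueD value_single mul1n.
have : y = 0%R \/ y = single i 1.
  have yvE k : y k + v k = single i 1 k by rewrite -addzE yv.
  have [yi|yi] := posnP (y i); [left|right]; apply: eqz => k.
    by have := yvE k; rewrite zero_zE singleE; case: eqP => [->|_]; lia.
  by have := yvE k; rewrite !singleE; case: eqP => [->|_]; lia.
case=> yE; rewrite yb yE; last by rewrite value_single mul1n.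
by have := generator_gt0 j mgb; rewrite yb yE value0.
Qed.

Lemma minimal_generators_unique (S : set nat) n m (a : 'I_n -> nat) (b : 'I_m -> nat) :
  minimal_generators S a -> minimal_generators S b ->
  exists2 f : 'I_n -> 'I_m, bijective f & forall i, b (f i) = a i.
Proof.
move=> mga mgb.
have [f fE] := fin_all_exists (generators_sub mga mgb).
have [g gE] := fin_all_exists (generators_sub mgb mga).
exists f => //; exists g => i.
  by apply: (generators_inj mga); rewrite gE fE.
by apply: (generators_inj mgb); rewrite fE gE.
Qed.

Section Reindex.
Variables (n m : nat) (f : 'I_n -> 'I_m) (g : 'I_m -> 'I_n).
Hypotheses (fK : cancel f g) (gK : cancel g f).

Definition reindex_z (z : factorization m) : factorization n := [ffun i => z (f i)].

Lemma reindex_zE z i : reindex_z z i = z (f i).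
Proof. by rewrite ffunE. Qed.

Lemma value_reindex (b : 'I_m -> nat) z : value (b \o f) (reindex_z z) = value b z.
Proof.
rewrite /value [RHS](reindex f) /=; last by exists g => i _.
by apply: eq_bigr => i _; rewrite reindex_zE.
Qed.

Lemma ell0_reindex z : ell0 (reindex_z z) = ell0 z.
Proof.
rewrite /ell0 -(@on_card_preimset _ _ f); last by exists g => i _; rewrite ?fK ?gK.
by apply: eq_card => i; rewrite !inE reindex_zE.
Qed.

Lemma reindex_zD z w : reindex_z (z + w)%R = (reindex_z z + reindex_z w)%R.
Proof. by apply: eqz => i; rewrite addzE !reindex_zE addzE. Qed.
End Reindex.

Lemma reindex_zK n m (f : 'I_n -> 'I_m) g :
  cancel g f -> cancel (reindex_z f) (reindex_z g).
Proof. by move=> gK z; apply: eqz => i; rewrite !reindex_zE gK. Qed.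

Lemma L0_reindex n m (f : 'I_n -> 'I_m) (b : 'I_m -> nat) x :
  bijective f -> L0 (b \o f) x = L0 b x.
Proof.
move=> [g fK gK]; apply/seteqP; split=> _ [z zx <-].
  exists (reindex_z g z); last by rewrite (ell0_reindex gK).
  by rewrite /Z_ /= zx -(value_reindex fK gK) (reindex_zK fK).
exists (reindex_z f z); last by rewrite (ell0_reindex fK).
by rewrite /Z_ /= zx (value_reindex fK gK).
Qed.

(** Any two minimal generating families differ by a bijection of the indices,
which preserves support sizes; one family therefore computes the union. *)
Lemma Delta0E (S : set nat) n (b : 'I_n -> nat) :
  minimal_generators S b -> Delta0 S = \bigcup_(x in S) Delta0_elt b x.
Proof.
move=> mg; apply/seteqP; split=> d; last by exists n, b.
move=> [m [a [mga [x Sx dx]]]]; exists x => //.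
have [f fB /funext aE] := minimal_generators_unique mg mga.
by move: dx; rewrite /Delta0_elt -(L0_reindex _ _ fB) /comp aE.
Qed.

(** * Gaps of the support sizes *)

Section Gaps.
Variables (S : set nat) (n : nat) (b : 'I_n -> nat).
Hypothesis mg : minimal_generators S b.
Implicit Types z u v : factorization n.

Lemma value_in z : S (value b z).
Proof. by rewrite -mg.1; exists z. Qed.

Lemma one_in_Delta0 : 2 <= n -> Delta0 S 1.
Proof.
case: n b mg => [|[|k]] // c mgc _.
pose i : 'I_k.+2 := ord0; pose j : 'I_k.+2 := ord_max.
have [ci cj] := (generator_gt0 i mgc, generator_gt0 j mgc).
pose z := single i (2 * c j); pose z' := (single i (c j) + single j (c i))%R.
have vzz' : value c z = value c z' by rewrite valueD !value_single; lia.
rewrite (Delta0E mgc); exists (value c z); first by rewrite -mgc.1; exists z.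
exists 1, 2; split=> //.
- by exists z => //; rewrite ell0_single muln_gt0 cj.
- exists z' => //; have -> : 2 = ell0 (single i (c j)) + ell0 (single j (c i)).
    by rewrite !ell0_single ci cj.
  rewrite /ell0 suppD cardsU (_ : _ :&: _ = finset.set0)%SET ?cards0 ?subn0 //.
  apply/setP => l; rewrite !inE !singleE; case: eqP => [->|] //=.
  by rewrite andbF.
- by move=> e _; lia.
Qed.

Lemma Delta0_of_exchange1 : 2 <= n ->
  (forall z z', value b z = value b z' -> linked (small b 1) z z') ->
  Delta0 S = [set 1].
Proof.
move=> n2 conn; apply/seteqP; split=> d /=; last by move=> ->; exact: one_in_Delta0.
by rewrite (Delta0E mg) => -[x _ /(linked_gap conn)]; lia.
Qed.

Lemma ell0_full z : (forall i, 0 < z i) -> ell0 z = n.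
Proof.
move=> z_gt0; rewrite /ell0 -[RHS]card_ord; apply: eq_card => i.
by rewrite suppE z_gt0.
Qed.

Lemma ell0_pred z : 0 < n -> ell0 z = n.-1 ->
  exists j, forall i, (0 < z i) = (i != j).
Proof.
move=> n_gt0 zn; have /cards1P[j zj] : #|~: supp z|%SET == 1.
  by have := cardsC (supp z); rewrite card_ord -/(ell0 z) zn; lia.
exists j => i; rewrite -suppE -[supp z]finset.setCK zj.
by rewrite !inE.
Qed.

(** The last hypothesis excludes the support size n - 1: a factorization with
the same value as z that misses only j would, after cancelling one copy of each
other generator, have the value of its right-hand side without using j.  The
largest support size below n then differs from n by exactly 2. *)
Lemma Delta0_of_exchange2 z z' i0 :
  2 <= n ->
  (forall y y', value b y = value b y' -> linked (small b 2) y y') ->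
  (forall i, 0 < z i) -> value b z' = value b z -> z' i0 = 0 ->
  (forall j v, value b v = value b [ffun i => z i - (i != j)] -> 0 < v j) ->
  Delta0 S = [set 1; 2].
Proof.
move=> n2 conn z_gt0 z'z z'i0 miss; set x := value b z.
have xn : L0 b x n by exists z => //; exact: ell0_full.
have xn1 : ~ L0 b x n.-1.
  move=> [u xu un]; have [|j uj] := ell0_pred _ un; first by lia.
  pose w : factorization n := [ffun i => (i != j) : nat].
  pose r : factorization n := [ffun i => z i - (i != j)].
  pose v : factorization n := [ffun i => u i - (i != j)].
  have wE i : w i = (i != j) by rewrite ffunE.
  have rE i : r i = z i - (i != j) by rewrite ffunE.
  have vE i : v i = u i - (i != j) by rewrite ffunE.
  have zE : z = (w + r)%R.
    by apply: eqz => i; rewrite addzE wE rE; have := z_gt0 i; case: eqP => /=; lia.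
  have uE : u = (w + v)%R.
    by apply: eqz => i; rewrite addzE wE vE; have := uj i; case: eqP => /=; lia.
  have : 0 < v j.
    have vz : value b z = value b w + value b r by rewrite -valueD -zE.
    have vu : value b u = value b w + value b v by rewrite -valueD -uE.
    by apply: miss; move: (xu : x = _); rewrite -/r /x vz vu => /addnI.
  by have := uj j; rewrite vE eqxx; lia.
have z'n : ell0 z' < n.
  rewrite -[ltnRHS]card_ord; apply: proper_card; apply/properP.
  by split; [exact/fintype.subsetP | exists i0; rewrite ?suppE ?z'i0].
pose P c := `[< L0 b x c >] && (c < n).
have exP : exists c, P c.
  by exists (ell0 z'); apply/andP; split=> //; apply/asboolP; exists z'.
have bP c : P c -> c <= n by case/andP => _; lia.
have [c /andP[/asboolP xc cn] cmax] := ex_maxnP exP bP.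
have dx : Delta0_elt b x (n - c).
  exists c, n; split=> // e xe; apply/negP => /andP[ce en].
  by have := cmax e; rewrite /P en andbT => /(_ (asboolT xe)); lia.
have nc1 : n - c != 1.
  by apply/negP => /eqP nc; apply: xn1; rewrite (_ : n.-1 = c) //; lia.
apply/seteqP; split=> d /=.
  rewrite (Delta0E mg) => -[y _ /(linked_gap conn)] d2.
  by have [->|] := eqVneq d 1; [left|right; lia].
case=> ->; first exact: one_in_Delta0.
rewrite (Delta0E mg); exists x; first exact: value_in.
by rewrite (_ : 2 = n - c) //; have := linked_gap conn dx; lia.
Qed.

End Gaps.

(** Induction on the value: once both factorizations use i0, one copy of that
generator is cancelled on both sides and restored at the end. *)
Lemma linked_by_descent n (b : 'I_n -> nat) rho i0 :
  (forall t, rho t -> value b t.1 = value b t.2) -> 0 < b i0 ->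
  (forall z z', value b z = value b z' -> linked rho z z' \/
     exists y y', [/\ linked rho z y, linked rho z' y', 0 < y i0 & 0 < y' i0]) ->
  forall z z', value b z = value b z' -> linked rho z z'.
Proof.
move=> rhoP b_gt0 step z; have [N] := ubnP (value b z).
elim: N z => // N IH z zN z' zz'.
have [//|[y [y' [zy zy' /single_le[w yE] /single_le[w' y'E]]]]] := step z z' zz'.
apply: (linked_trans zy); apply: linked_sym; apply: (linked_trans zy').
have := linked_value rhoP zy; have := linked_value rhoP zy'.
rewrite yE y'E !valueD value_single mul1n => v v'.
by apply/linkedD/linked_sym/IH; lia.
Qed.

(** * Presentations *)

Lemma trade_disjoint n (b : 'I_n -> nat) t i :
  is_trade b t -> t.1 i = 0 \/ t.2 i = 0.
Proof.
move=> [_ /disjointFr dis].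
have [|t1] := posnP (t.1 i); first by left.
by right; have := dis i; rewrite !suppE t1 => /(_ isT); lia.
Qed.

(** Disjoint supports make the common part w of an integer difference
nonnegative. *)
Lemma diff_tradeP n (b : 'I_n -> nat) t y y' : is_trade b t ->
  diff_trade t y y' <-> exists w : factorization n, y = (w + t.1)%R /\ y' = (w + t.2)%R.
Proof.
move=> tr; split=> [dt|[w [-> ->]] i]; last by rewrite !addzE; lia.
exists [ffun i => y i - t.1 i].
have e i : y i = y i - t.1 i + t.1 i /\ y' i = y i - t.1 i + t.2 i.
  have := dt i; case: (trade_disjoint i tr) => ->; lia.
by split; apply: eqz => i; rewrite addzE ffunE; case: (e i).
Qed.

Lemma exchange_diff n (b : 'I_n -> nat) rho z z' : (forall t, rho t -> is_trade b t) ->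
  exchange rho z z' <-> exists2 t, rho t & diff_trade t z z'.
Proof.
move=> tr; split=> [] [t rt].
  by exists t => //; apply/(diff_tradeP _ _ (tr _ rt)).
by move/(diff_tradeP _ _ (tr _ rt)); exists t.
Qed.

(** The indexed chains in the definition of a presentation are replaced by a
closure, which supports induction and monotonicity. *)
Lemma presentationP n (b : 'I_n -> nat) rho : (forall t, rho t -> is_trade b t) ->
  presentation b rho <->
  forall z z', value b z = value b z' -> linked rho z z'.
Proof.
move=> tr; split=> [[_ conn] z z' zz'|conn].
  have [r [y [<- <- _ steps]]] := conn _ z z' erefl zz'.
  elim: r steps => [|r IH] steps; first exact: linked_refl.
  apply: linked_trans (IH _) _ => [i ir|]; first by apply: steps; lia.
  have [t rt [] dt] := steps r (leqnn _); last first.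
    by apply: rst_step; apply/(exchange_diff _ _ tr); exists t.
  by apply: linked_sym; apply: rst_step; apply/(exchange_diff _ _ tr); exists t.
split=> // x z z' zx z'x.
pose joined (u v : factorization n) := exists r (y : nat -> factorization n),
  [/\ y 0 = u, y r = v & forall i, i < r -> exists2 t, rho t &
      diff_trade t (y i.+1) (y i) \/ diff_trade t (y i) (y i.+1)].
have joinedP u v : linked rho u v -> joined u v.
  elim=> {u v} [u v /(exchange_diff _ _ tr)[t rt dt]|u|u v _ [r [y [y0 yr st]]]
               |u y v _ [r [p [p0 pr ps]]] _ [s [q [q0 qs st]]]].
  - exists 1, (fun i => if i is 0 then u else v); split=> // -[|//] _.
    by exists t => //; right.
  - by exists 0, (fun=> u).
  - exists r, (fun i => y (r - i)); split=> [||i ir]; rewrite ?subn0 ?subnn //.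
    have [|t rt dt] := st (r - i.+1); first by lia.
    exists t => //; move: dt; rewrite (_ : (r - i.+1).+1 = r - i); last by lia.
    by case; [right|left].
  - exists (r + s), (fun i => if i < r then p i else q (i - r)); split.
    + by case: posnP => [r0|//]; rewrite sub0n q0 -pr r0.
    + by rewrite ltnNge leq_addr /= addKn.
    + move=> i irs; case: (ltngtP i.+1 r) => [ir|ir|ir].
      * by apply: ps; lia.
      * rewrite subSn; last by lia.
        by apply: st; lia.
      * by rewrite ir subnn q0 -pr -ir; apply: ps; lia.
have [r [y [y0 yr st]]] := joinedP z z' (conn _ _ (etrans (esym zx) z'x)).
exists r, y; split=> // i; elim: i => [_|i IH ir]; first by rewrite y0.
have xi := IH (ltnW ir); rewrite /Z_ /= xi.
have [t rt dt] := st i ir.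
have vt t' : rho t' -> value b t'.1 = value b t'.2 by move/tr => -[].
have vdiff v w : diff_trade t v w -> value b v = value b w.
  move=> vw; apply: (linked_value vt); apply: rst_step.
  by apply/(exchange_diff _ _ tr); exists t.
by case: dt => /vdiff.
Qed.

Lemma singleton_presentation_linked n (b : 'I_n -> nat) :
  has_singleton_presentation b ->
  forall z z', value b z = value b z' -> linked (small b 1) z z'.
Proof.
move=> [rho [[pres _] sing]] z z' zz'; have tr := pres.1.
apply: (linked_sub (rho := rho)); last exact: ((presentationP tr).1 pres).
by move=> t rt; have [s1 s2] := sing _ rt; split; rewrite ?s1 ?s2 //; case: (tr _ rt).
Qed.

(** Finiteness allows discarding trades one presentation at a time until no
proper subfamily presents. *)
Lemma has_minimal_subpresentation n (b : 'I_n -> nat)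
    (s : seq (factorization n * factorization n)) :
  presentation b [set` s] ->
  exists2 rho, rho `<=` [set` s] & minimal_presentation b rho.
Proof.
have [N] := ubnP (size s); elim: N s => // N IH s sN pres.
have [[rho [sub prho ne]]|no] := EM (exists rho,
    [/\ rho `<=` [set` s], presentation b rho & rho <> [set` s]]); last first.
  exists [set` s] => //; split=> // rho sub prho.
  by apply: contrapT => ne; apply: no; exists rho.
pose s' := [seq t <- s | `[< rho t >]].
have s'E : [set` s'] = rho.
  apply/seteqP; split=> t /=; first by rewrite mem_filter => /andP[/asboolP].
  by move=> rt; rewrite mem_filter (asboolT rt); apply: sub.
have s's : size s' < size s.
  rewrite size_filter ltn_neqAle count_size andbT -all_count.
  apply/negP => /allP all_s; apply: ne; apply/seteqP; split=> // t ts.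
  exact/asboolP/all_s.
have [||r rsub rmin] := IH s'; rewrite ?s'E //; first exact: leq_trans s's sN.
exists r => //; by rewrite -s'E in sub; apply: subset_trans rsub _.
Qed.

(** The reindexing by f is built in because a semigroup is given by one minimal
family and is known to be special through another one. *)
Lemma has_singleton_presentation_of_seq n m (f : 'I_n -> 'I_m) (b : 'I_m -> nat)
    (s : seq (factorization m * factorization m)) :
  bijective f ->
  (forall t, t \in s -> [/\ is_trade b t, ell0 t.1 = 1 & ell0 t.2 = 1]) ->
  (forall z z', value b z = value b z' -> linked [set` s] z z') ->
  has_singleton_presentation (b \o f).
Proof.
move=> [g fK gK] sP conn.
pose F (t : factorization m * factorization m) := (reindex_z f t.1, reindex_z f t.2).
have s'P t : t \in map F s ->
    [/\ is_trade (b \o f) t, ell0 t.1 = 1 & ell0 t.2 = 1].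
  move=> /mapP[u /sP[[vu du] u1 u2] ->]; rewrite !(ell0_reindex fK gK); split=> //.
  split; first by rewrite !(value_reindex fK gK).
  apply/pred0P => i /=; rewrite !suppE !reindex_zE.
  by have := pred0P du (f i); rewrite /= !suppE.
have linkF z z' : linked [set` s] z z' ->
    linked [set` map F s] (reindex_z f z) (reindex_z f z').
  elim=> {z z'} [_ _ [t rt [u [-> ->]]]|z|z z' _|z y z' _ zy _ yz'].
  - rewrite !reindex_zD; apply: (linked_exchange (t := F t)).
    exact: map_f.
  - exact: linked_refl.
  - exact: linked_sym.
  - exact: linked_trans zy yz'.
have [|rho sub min] := @has_minimal_subpresentation _ (b \o f) (map F s).
  apply/presentationP => [t /s'P[]//|z z' zz'].
  rewrite -(reindex_zK fK z) -(reindex_zK fK z').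
  by apply/linkF/conn; rewrite -!(value_reindex fK gK) !(reindex_zK fK).
by exists rho; split=> // t /sub /s'P[].
Qed.

(** * Triangular families of trades *)

Lemma linked_single_mul n rho (i j : 'I_n) c d q w :
  rho (single i c, single j d) ->
  linked rho (w + single i (q * c))%R (w + single j (q * d))%R.
Proof.
move=> rt; elim: q w => [|q IH] w.
  by rewrite !mul0n !single0; exact: linked_refl.
rewrite !mulSn !singleD !addrA.
apply: (linked_trans (y := (w + single j d + single i (q * c))%R)); last exact: IH.
rewrite -!addrA ![(_ + single i (q * c))%R]addrC !addrA.
exact: (linked_exchange _ rt).
Qed.

(** The trades alpha_i b_i ~ beta_j b_j, for consecutive i and j, suffice as soon
as D_i alpha_i divides all later generators while b_i = D_i u_i with u_i prime
to alpha_i: modulo D_i alpha_i, only the class of z_i modulo alpha_i is visible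
in the value once the earlier coordinates are known. *)
Section TriangularTrades.
Variables (n : nat) (g al be D u : 'I_n -> nat).
Hypotheses (al_gt0 : forall i, 0 < al i) (be_gt0 : forall i, 0 < be i).
Hypotheses (g_gt0 : forall i, 0 < g i).
Hypothesis trade_eq : forall i j : 'I_n, j = i.+1 :> nat -> al i * g i = be j * g j.
Hypotheses (gE : forall i, g i = D i * u i) (cop : forall i, coprime (al i) (u i)).
Hypothesis later_dvd : forall i l : 'I_n, i < l -> D i * al i %| g l.

Definition triangular_trades : seq (factorization n * factorization n) :=
  [seq (single ij.1 (al ij.1), single ij.2 (be ij.2)) |
     ij <- enum [pred ij : 'I_n * 'I_n | ij.2 == ij.1.+1 :> nat]].

Lemma triangular_tradesP t : t \in triangular_trades ->
  [/\ is_trade g t, ell0 t.1 = 1 & ell0 t.2 = 1].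
Proof.
move=> /mapP[[i j]]; rewrite mem_enum inE /= => /eqP ij ->.
rewrite !ell0_single al_gt0 be_gt0; split=> //; split=> /=.
  by rewrite !value_single; apply: trade_eq.
apply/pred0P => l /=; rewrite !suppE !singleE; case: eqP => [->|] //.
by case: eqP => [e|]; rewrite ?andbF //; move: ij; rewrite e; lia.
Qed.

Lemma value_split (j : 'I_n) z : value g z =
  \sum_(i < n | i < j) z i * g i + z j * g j + \sum_(i < n | j < i) z i * g i.
Proof.
rewrite /value (bigID (fun i : 'I_n => i < j)) /= -addnA; congr (_ + _).
rewrite (bigD1 j) ?ltnn //=; congr (_ + _); apply: eq_bigl => i.
by rewrite -leqNgt [RHS]ltn_neqAle andbC eq_sym.
Qed.

Lemma triangular_congr (j : 'I_n) z z' : value g z = value g z' ->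
  (forall i : 'I_n, i < j -> z i = z' i) -> z' j <= z j -> al j %| z j - z' j.
Proof.
move=> vzz' agree le.
have Dal y : D j * al j %| \sum_(i < n | j < i) y i * g i.
  by apply: dvdn_sum => i ji; rewrite dvdn_mull // later_dvd.
move: vzz'; rewrite !(value_split j).
rewrite (eq_bigr (fun i : 'I_n => z' i * g i)) => [|i ij]; last by rewrite agree.
have := Dal z; have := Dal z'; move: (\sum_(i < n | j < i) _) => B'.
move: (\sum_(i < n | j < i) _) => B dB' dB /eqP; rewrite -!addnA eqn_add2l => /eqP e.
have D_gt0 : 0 < D j by have := g_gt0 j; rewrite gE muln_gt0 => /andP[].
rewrite -(Gauss_dvdl _ (cop j)) -(dvdn_pmul2l D_gt0).
have -> : D j * ((z j - z' j) * u j) = B' - B.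
  rewrite mulnCA -gE mulnBl; lia.
exact: dvdn_sub.
Qed.

(** Coordinates are made equal from the first to the last; a surplus in
coordinate j is pushed into coordinate j + 1. *)
Lemma triangular_linked z z' : value g z = value g z' ->
  linked [set` triangular_trades] z z'.
Proof.
(* k counts the coordinates on which z and z' may still differ. *)
suff H k : k <= n -> forall z z', value g z = value g z' ->
    (forall i : 'I_n, i < n - k -> z i = z' i) ->
    linked [set` triangular_trades] z z'.
  by move=> vzz'; apply: (H n) => // i; rewrite subnn.
elim: k => [_ {}z {}z' _ agree|k IH kn {}z {}z' vzz' agree].
  have -> : z = z' by apply: eqz => i; apply: agree; rewrite subn0.
  exact: linked_refl.
have jn : n - k.+1 < n by lia.
pose j := Ordinal jn.
wlog le : z z' vzz' agree / z' j <= z j.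
  move=> wl; have [|lt] := leqP (z' j) (z j); first exact: wl.
  by apply: linked_sym; apply: wl (ltnW lt) => // i ij; rewrite agree.
have agree_to (y : factorization n) :
    (forall i : 'I_n, i < j -> y i = z' i) -> y j = z' j ->
    forall i : 'I_n, i < n - k -> y i = z' i.
  move=> yi yj i; rewrite (_ : n - k = j.+1) ?ltnS; last by rewrite /=; lia.
  rewrite leq_eqVlt => /orP[/eqP ij|]; last exact: yi.
  by rewrite (_ : i = j) //; apply: val_inj.
have [zj|ne] := eqVneq (z j) (z' j).
  by apply: IH => //; [lia | exact: agree_to].
have /dvdnP[q qE] := triangular_congr (j := j) vzz' agree le.
have [jjn|last_j] := ltnP j.+1 n; last first.
  (* In the last coordinate the value leaves no room for a surplus. *)
  have none y : \sum_(i < n | j < i) y i * g i = 0.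
    by apply: big1 => i ji; have := ltn_ord i; lia.
  move: vzz'; rewrite !(value_split j) !none !addn0.
  rewrite (eq_bigr (fun i : 'I_n => z' i * g i)) => [|i ij]; last by rewrite agree.
  by move/addnI/eqP; rewrite eqn_pmul2r // (negPf ne).
pose jj := Ordinal jjn.
have [w zE] : exists w : factorization n, z = (single j (q * al j) + w)%R.
  by apply: single_le; lia.
have zw i : z i = (if i == j then q * al j else 0) + w i.
  by rewrite -singleE -addzE -zE.
have link : linked [set` triangular_trades] z (w + single jj (q * be jj))%R.
  rewrite zE addrC; apply: linked_single_mul; apply/mapP; exists (j, jj) => //.
  by rewrite mem_enum inE.
apply: (linked_trans link); apply: IH; first by lia.
  rewrite -vzz' zE !valueD !value_single addnC -!mulnA (@trade_eq j jj) //.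
have jjE i : (i == jj) = (i == j.+1 :> nat) by [].
apply: agree_to => [i ij|]; rewrite addzE singleE jjE.
  rewrite -agree // zw; have -> : (i == j) = false by apply/eqP => e; move: ij; rewrite e ltnn.
  by rewrite (ltn_eqF (ltnW ij : i < j.+1)) addn0 add0n.
have := zw j; rewrite eqxx (ltn_eqF (leqnn _ : j < j.+1)); lia.
Qed.

Lemma triangular_singleton_presentation m (f : 'I_m -> 'I_n) :
  bijective f -> has_singleton_presentation (g \o f).
Proof.
move=> fB.
exact: has_singleton_presentation_of_seq fB triangular_tradesP triangular_linked.
Qed.
End TriangularTrades.

(** Here alpha = beta = p and D = 1: every T / p_l with l <> i is a multiple of
p_i, while T / p_i is prime to p_i. *)
Lemma supersymmetric_singleton_presentation (S : set nat) k (a : 'I_k -> nat) :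
  minimal_generators S a -> supersymmetric S -> has_singleton_presentation a.
Proof.
move=> mga [n [p [p_gt0 cop mgp]]].
have [f fB /funext <-] := minimal_generators_unique mga mgp.
pose q i := \prod_(j < n | j != i) p j.
have TE i : \prod_(j < n) p j = p i * q i by rewrite (bigD1 i).
have gE i : (\prod_(j < n) p j) %/ p i = q i by rewrite (TE i) mulKn.
have mul i : p i * ((\prod_(j < n) p j) %/ p i) = \prod_(j < n) p j.
  by rewrite gE -TE.
apply: (@triangular_singleton_presentation n (fun i => (\prod_(j < n) p j) %/ p i)
          p p (fun=> 1) q) => //.
- by move=> i; apply: generator_gt0 mgp.
- by move=> i j _; rewrite !mul.
- by move=> i; rewrite gE mul1n.
- move=> i; rewrite /q; apply: (big_ind (fun x => coprime (p i) x)).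
  + exact: coprimen1.
  + by move=> x y cx cy; rewrite coprimeMr cx.
  + by move=> j ji; apply: cop; rewrite eq_sym.
- move=> i l il; rewrite mul1n gE /q (bigD1 i) ?dvdn_mulr //.
  by apply/eqP => e; move: il; rewrite e ltnn.
Qed.

(** With ratio d / c, the trades are d b_i ~ c b_(i+1), and D_i = d ^ i is the
power of d in the i-th generator. *)
Lemma geometric_singleton_presentation (S : set nat) k (a : 'I_k -> nat) :
  minimal_generators S a -> geometric S -> has_singleton_presentation a.
Proof.
move=> mga [n [c [d [c_gt0 cd cop mgg]]]].
have [f fB /funext <-] := minimal_generators_unique mga mgg.
apply: (@triangular_singleton_presentation n
          (fun i => c ^ (n - i.+1) * d ^ i) (fun=> d) (fun=> c)
          (fun i => d ^ i) (fun i => c ^ (n - i.+1))) => //.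
- by move=> _; lia.
- by move=> i; apply: generator_gt0 mgg.
- move=> i j ji; have := ltn_ord j; rewrite ji => jn.
  by rewrite mulnCA -expnS mulnA -expnS; congr (_ ^ _ * _); lia.
- by move=> i; rewrite mulnC.
- by move=> i; rewrite coprimeXr // coprime_sym.
- by move=> i l il; rewrite -expnSr dvdn_mull // dvdn_exp2l.
Qed.

(** * Maximal embedding dimension *)

Section MaximalEmbeddingDimension.
Variables (S : set nat) (m : nat) (g : 'I_m.+3 -> nat).
Hypotheses (g0 : g ord0 = m.+3) (g_mod : forall i, g i = i %[mod m.+3]).
Hypothesis mg : minimal_generators S g.

Lemma med_sum_opposite (i j : 'I_m.+3) : m.+3 %| i + j ->
  exists2 c, 0 < c & g i + g j = c * g ord0.
Proof.
move=> dij; have /dvdnP[c cE] : m.+3 %| g i + g j.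
  by rewrite /dvdn -modnDm !g_mod modnDm.
exists c; last by rewrite g0.
by rewrite lt0n; apply: contra_eqN cE => /eqP ->; have := generator_gt0 i mg; lia.
Qed.

(** If i + j is not 0 modulo g_0, let r be its residue.  Then g_i + g_j exceeds
g_r, since otherwise g_r would be g_i + g_j plus copies of g_0, which minimality
forbids; the excess is a positive multiple of g_0. *)
Lemma med_trade (i j : 'I_m.+3) : exists y : factorization m.+3,
  [/\ value g y = g i + g j, 0 < y ord0 & ell0 y <= 2].
Proof.
have [dij|nij] := boolP (m.+3 %| i + j).
  have [c c_gt0 cE] := med_sum_opposite dij.
  exists (single ord0 c); rewrite value_single singleE eqxx.
  by split=> //; apply: leq_trans (ell0_single_le _ _) _.
have rm : (i + j) %% m.+3 < m.+3 by rewrite ltn_mod.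
pose r := Ordinal rm.
have r_mod : g i + g j = g r %[mod m.+3].
  by rewrite -modnDm !g_mod modnDm modn_mod.
have [le|lt] := leqP (g i + g j) (g r).
  have /dvdnP[c cE] : m.+3 %| g r - (g i + g j).
    by rewrite -eqn_mod_dvd //; apply/eqP.
  have u : (single i 1 + single j 1 + single ord0 c)%R = single r 1.
    apply: generator_factorization_unique mg _.
    by rewrite !valueD !value_single g0; lia.
  have at_ l : single i 1 l + single j 1 l + single ord0 c l = single r 1 l.
    by rewrite -!addzE u.
  have := at_ i; have := at_ j; rewrite !singleE !eqxx.
  by case: (eqVneq i r) => [->|_]; case: (eqVneq j r) => [->|_]; rewrite ?eqxx; lia.
have /dvdnP[c cE] : m.+3 %| g i + g j - g r.
  by rewrite -eqn_mod_dvd; [apply/eqP | lia].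
exists (single ord0 c + single r 1)%R; split; last exact: ell0_two_le.
  by rewrite valueD !value_single g0; lia.
by rewrite addzE singleE eqxx; case: c cE => [|c] //; lia.
Qed.

(** A factorization of length at most 1 is alone in its fiber; any longer one
contains two generators that can be traded for a factorization using g_0. *)
Lemma med_descent z : (exists y, linked (small g 2) z y /\ 0 < y ord0) \/
  (forall z', value g z' = value g z -> z' = z).
Proof.
have [->|/factorization_neq0[i [w ->]]] := EM (z = 0%R).
  right=> z'; rewrite value0; apply: value_eq0 => l; exact: generator_gt0 mg.
have [->|/factorization_neq0[j [v ->]]] := EM (w = 0%R).
  right=> z'; rewrite addr0 value_single mul1n.
  exact: generator_factorization_unique mg.
have [y [vy y0 y2]] := med_trade i j.
left; exists (v + y)%R; split; last by rewrite addzE; lia.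
rewrite addrA addrC; apply: linked_small => //; last exact: ell0_two_le.
by rewrite valueD !value_single !mul1n.
Qed.

Lemma med_linked z z' : value g z = value g z' -> linked (small g 2) z z'.
Proof.
apply: (linked_by_descent (i0 := ord0)) => [t /smallP||{}z {}z' zz'] //.
  by rewrite g0.
have [[y [zy y0]]|uz] := med_descent z; last first.
  by left; rewrite (uz z') //; exact: linked_refl.
have [[y' [zy' y0']]|uz'] := med_descent z'; first by right; exists y, y'.
by left; rewrite (uz' z) //; exact: linked_refl.
Qed.

Lemma med_Delta0 : Delta0 S = [set 1; 2].
Proof.
(* The indices 1 and g_0 - 1 are distinct because g_0 >= 3, and their
   generators add up to a multiple of g_0: this gives the second factorization
   of the full sum. *)
pose i : 'I_m.+3 := inord 1; pose j : 'I_m.+3 := ord_max.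
have iE : i = 1 :> nat by rewrite inordK.
have [|c c_gt0 cE] := @med_sum_opposite i j; first by rewrite iE.
pose w : factorization m.+3 := [ffun l => ((l != i) && (l != j) : nat)].
pose z : factorization m.+3 := [ffun=> 1].
have wE l : w l = (l != i) && (l != j) by rewrite ffunE.
have zE l : z l = 1 by rewrite ffunE.
have ij : i != j by apply/eqP => /(congr1 val) /=; rewrite iE.
have zD : z = (w + (single i 1 + single j 1))%R.
  apply: eqz => l; rewrite !addzE !singleE wE zE.
  by case: (eqVneq l i) => [->|_]; rewrite ?(negPf ij) //=; case: eqP.
apply: (@Delta0_of_exchange2 S _ g mg z (w + single ord0 c)%R i) => //.
- exact: med_linked.
- by move=> l; rewrite zE.
- by rewrite zD !valueD !value_single; lia.
- rewrite addzE wE eqxx singleE /=; case: eqP => // /(congr1 val) /=.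
  by rewrite iE.
- move=> l v; have -> : [ffun s => z s - (s != l)] = single l 1.
    by apply: eqz => s; rewrite ffunE zE singleE; case: eqP.
  by rewrite value_single mul1n; apply: generator_needed mg.
Qed.

End MaximalEmbeddingDimension.

(** * Generalized arithmetic sequences *)

Section ArithmeticSequence.
Variables (a d h k : nat).
Hypotheses (a_gt0 : 0 < a) (d_gt0 : 0 < d) (h_gt0 : 0 < h).
Hypotheses (k_ge2 : 2 <= k) (k_lt_a : k < a) (cop : coprime a d).

Let g (i : 'I_k.+1) : nat := if i == 0 :> nat then a else a * h + i * d.
Implicit Types z v y : factorization k.+1.

(** The number of generators other than a, and their total multiple of d: the
value of a factorization is a linear function of these two numbers and of the
multiplicity of a. *)
Definition upper_length z : nat := \sum_(i < k.+1 | i != ord0) z i.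
Definition weight z : nat := \sum_(i < k.+1) z i * i.

Lemma upper_lengthD z v : upper_length (z + v)%R = upper_length z + upper_length v.
Proof. by rewrite -big_split; apply: eq_bigr => i _; rewrite addzE. Qed.

Lemma upper_length_single i c :
  upper_length (single i c) = if i == ord0 then 0 else c.
Proof.
rewrite /upper_length; have [->|ni] := eqVneq i ord0.
  by apply: big1 => j /negPf nj; rewrite singleE nj.
rewrite (bigD1 i) //= singleE eqxx big1 ?addn0 // => j /andP[_ /negPf nj].
by rewrite singleE nj.
Qed.

Lemma upper_length0 : upper_length 0%R = 0.
Proof. by apply: big1 => i _; rewrite zero_zE. Qed.

Lemma weightD z v : weight (z + v)%R = weight z + weight v.
Proof. exact: valueD. Qed.

Lemma weight_single i c : weight (single i c) = c * i.
Proof. exact: value_single. Qed.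

Lemma weight0 : weight 0%R = 0.
Proof. exact: value0. Qed.

Lemma arith_value z : value g z = a * (z ord0 + h * upper_length z) + d * weight z.
Proof.
elim/factorization_ind: z => [|i z IH].
  by rewrite value0 upper_length0 weight0 zero_zE; lia.
rewrite valueD upper_lengthD weightD addzE IH value_single upper_length_single.
rewrite weight_single singleE [ord0 == i]eq_sym /g !mul1n.
rewrite -[i == 0 :> nat]/(i == ord0).
case: eqVneq => [->|_] /=; lia.
Qed.

Lemma weight_bounds z : upper_length z <= weight z <= k * upper_length z.
Proof.
elim/factorization_ind: z => [|i z IH]; first by rewrite upper_length0 weight0.
rewrite upper_lengthD weightD upper_length_single weight_single.
have := ltn_ord i; case: eqVneq => [->|ni] /=; first by lia.
have : 0 < i by rewrite lt0n.
by lia.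
Qed.

(** Modulo a the value determines the weight, which can thus only grow by a
multiple t a.  A larger weight needs at least as long a factorization, since
L is the least length possible for weight w when k L < w + k; but with z_0 < h
the multiples of a available do not pay for one more generator, and at equal
length the weight stays at most k L < w + k < w + a. *)
Lemma arith_rigid z z' : value g z = value g z' ->
  z ord0 < h -> weight z < a -> k * upper_length z < weight z + k ->
  [/\ z' ord0 = z ord0, upper_length z' = upper_length z & weight z' = weight z].
Proof.
rewrite !arith_value.
have := weight_bounds z; have := weight_bounds z'.
move: (z ord0) (z' ord0) (upper_length z) (upper_length z') (weight z) (weight z').
move=> x x' l l' w w' /andP[_ w'k] /andP[lw wk] e xh wa kl.
have [ww'|w'w] := leqP w w'; last first.
  have : a %| w - w'.
    rewrite -(Gauss_dvdr _ cop); apply/dvdnP; exists ((x' + h * l') - (x + h * l)).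
    by rewrite mulnBr mulnBl; lia.
  by move/dvdn_leq; lia.
have /dvdnP[t tE] : a %| w' - w.
  rewrite -(Gauss_dvdr _ cop); apply/dvdnP; exists ((x + h * l) - (x' + h * l')).
  by rewrite mulnBr mulnBl; lia.
have w'E : w' = w + t * a by lia.
have /eqP : a * (x + h * l) = a * (x' + h * l' + d * t) by rewrite w'E in e; lia.
rewrite eqn_pmul2l // => /eqP xE.
have ll' : l <= l'.
  rewrite leqNgt; apply/negP => lt; have : k * l'.+1 <= k * l by rewrite leq_mul2l lt orbT.
  by lia.
have l'l : l' <= l.
  by rewrite -ltnS -(ltn_pmul2l h_gt0) mulnS; lia.
have lE : l' = l by lia.
rewrite lE in w'k xE.
have t0 : t = 0.
  by case: t {tE xE} w'E => // t w'E; rewrite mulSn in w'E; lia.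
by move: w'E xE; rewrite t0; split; lia.
Qed.

Lemma upper_length_eq1 v (j : 'I_k.+1) :
  upper_length v = 1 -> weight v = j -> 0 < v j.
Proof.
move=> v1 vj; have [i i0 vi] : exists2 i, i != ord0 & 0 < v i.
  have [/existsP[i /andP[]]|/existsPn no] := boolP [exists i, (i != ord0) && (0 < v i)].
    by exists i.
  move: v1; rewrite /upper_length big1 // => i i0; have := no i; rewrite i0; lia.
have [w vE] := single_le vi.
move: v1 vj; rewrite vE upper_lengthD weightD upper_length_single weight_single.
rewrite (negPf i0) mul1n => w1; have w0 : upper_length w = 0 by lia.
have := weight_bounds w; rewrite w0 muln0 leqn0 => /eqP ->.
rewrite addn0 => /val_inj <-.
by rewrite addzE singleE eqxx.
Qed.

(** Every generator other than a exceeds h a.  The case c = 1 is minimality; the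
case c = h excludes the support size k. *)
Lemma first_generator_needed c v :
  0 < c <= h -> value g v = c * a -> 0 < v ord0.
Proof.
move=> /andP[c_gt0 ch]; rewrite arith_value lt0n => e; apply/eqP => v0.
move: e (weight_bounds v); rewrite v0 add0n.
case: (upper_length v) => [|l] e /andP[lw wk].
  have w0 : weight v = 0 by lia.
  by move: e; rewrite w0 !muln0 => /esym/eqP; rewrite muln_eq0; lia.
have : c * a <= a * (h * l.+1).
  by rewrite mulnC leq_mul2l (leq_trans ch) ?orbT // leq_pmulr.
have : 0 < d * weight v by rewrite muln_gt0 d_gt0; lia.
lia.
Qed.

(** With c < h copies of a and one g_j, length and weight are rigid, so every
other factorization also has one generator other than a, of weight j.  The case
c = 0 is minimality; the case c = h - 1 excludes the support size k. *)
Lemma later_generator_needed c (j : 'I_k.+1) v : c < h -> j != ord0 ->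
  value g v = c * a + g j -> 0 < v j.
Proof.
move=> ch j0 vE; have jk := ltn_ord j.
have j_gt0 : 0 < j by rewrite lt0n.
have [|||| _] := @arith_rigid (single ord0 c + single j 1)%R v.
- by rewrite valueD !value_single vE mul1n {1}/g.
- by rewrite addzE !singleE eqxx eq_sym (negPf j0); lia.
- by rewrite weightD !weight_single /=; lia.
- rewrite weightD upper_lengthD !weight_single !upper_length_single.
  by rewrite eqxx (negPf j0); lia.
rewrite weightD upper_lengthD !weight_single !upper_length_single eqxx (negPf j0).
rewrite muln0 mul1n !add0n; exact: upper_length_eq1.
Qed.

Lemma arith_minimal : minimal_generators (generated g) g.
Proof.
apply: minimal_generators_of_needed => i z zi.
have [i0|i0] := eqVneq i ord0.
  rewrite i0; apply: (@first_generator_needed 1); first by rewrite h_gt0.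
  by rewrite zi i0 mul1n.
by apply: (@later_generator_needed 0).
Qed.

Let e i : 'I_k.+1 := inord i.

Lemma g_inord i : 0 < i <= k -> g (e i) = a * h + i * d.
Proof. by case/andP=> i0 ik; rewrite /g /e inordK // (gtn_eqF i0). Qed.

Lemma g_ord0 : g ord0 = a.
Proof. by []. Qed.

Lemma pair_trade_low i j w : 0 < i -> 0 < j -> i + j <= k ->
  linked (small g 2) (w + (single (e i) 1 + single (e j) 1))%R
                     (w + (single ord0 h + single (e (i + j)) 1))%R.
Proof.
move=> i0 j0 ijk; apply: linked_small; rewrite ?ell0_two_le //.
by rewrite !valueD !value_single g_ord0 !g_inord; lia.
Qed.

Lemma pair_trade_high i j w : i <= k -> j <= k -> k < i + j ->
  linked (small g 2) (w + (single (e i) 1 + single (e j) 1))%R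
                     (w + (single (e (i + j - k)) 1 + single (e k) 1))%R.
Proof.
move=> ik jk ijk; apply: linked_small; rewrite ?ell0_two_le //.
by rewrite !valueD !value_single !g_inord; lia.
Qed.

(** Lowering the weight from a + s to s is paid for by d copies of a, together
with h copies of a for each other generator that disappears. *)
Lemma wrap_trade r q : 0 < r <= k -> a <= r + q * k < a + k ->
  exists2 y, linked (small g 2) (single (e r) 1 + single (e k) q)%R y & 0 < y ord0.
Proof.
move=> rk /andP[ar rak].
have [s sE] : exists s, r + q * k = a + s by exists (r + q * k - a); lia.
have rs : r * d + q * (k * d) = a * d + s * d by rewrite mulnA -!mulnDl sE.
have vE : value g (single (e r) 1 + single (e k) q)%R = a * h * q.+1 + a * d + s * d.
  rewrite valueD !value_single !g_inord; lia.
have [s0|s_gt0] := posnP s.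
  exists (single ord0 (h * q.+1 + d)); last by rewrite singleE eqxx; lia.
  rewrite -[X in linked _ X]add0r -[X in linked _ _ X]add0r.
  apply: linked_small; rewrite ?ell0_two_le ?vE ?value_single ?s0 //=.
    by rewrite g_ord0; lia.
  by apply: leq_trans (ell0_single_le _ _) _.
exists (single ord0 (h * q + d) + single (e s) 1)%R; last first.
  by rewrite addzE singleE eqxx; lia.
rewrite -[X in linked _ X]add0r -[X in linked _ _ X]add0r.
apply: linked_small; rewrite ?ell0_two_le ?vE ?valueD ?value_single //.
by rewrite g_inord; [rewrite g_ord0; lia | lia].
Qed.

(** Adding b_i to a normal form b_r + q b_k either produces a at once, or turns the
pair b_i + b_r into b_(i+r-k) + b_k; the weight then stays below a + k, so that
a single wrapping suffices. *)
Lemma arith_normal_form z :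
  [\/ exists2 y, linked (small g 2) z y & 0 < y ord0, z = 0%R |
      exists r q, [/\ 0 < r <= k, r + q * k < a &
        linked (small g 2) z (single (e r) 1 + single (e k) q)%R]].
Proof.
elim/factorization_ind: z => [|i z IH]; first by constructor 2.
have [->|i0] := eqVneq i ord0.
  constructor 1; exists (single ord0 1 + z)%R; first exact: linked_refl.
  by rewrite addzE singleE eqxx.
have i_gt0 : 0 < i by rewrite lt0n.
have ik := ltn_ord i.
have eiE : single i 1 = single (e i) 1 by rewrite /e inord_val.
case: IH => [[y zy y0]|->|[r [q [rk rqa zr]]]].
- constructor 1; exists (single i 1 + y)%R; first exact: linkedD.
  by rewrite addzE; lia.
- constructor 3; exists i, 0; split; [lia|lia|].
  by rewrite -eiE single0; exact: linked_refl.
have {}zr := linkedD (single i 1) zr.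
have shuffle : (single i 1 + (single (e r) 1 + single (e k) q))%R =
    (single (e k) q + (single (e i) 1 + single (e r) 1))%R.
  by rewrite eiE addrA addrC.
rewrite shuffle in zr.
have [irk|kir] := leqP (i + r) k.
  constructor 1; exists (single (e k) q + (single ord0 h + single (e (i + r)) 1))%R.
    by apply: (linked_trans zr); apply: pair_trade_low => //; lia.
  by rewrite !addzE [single ord0 h _]singleE eqxx; lia.
have zr' : linked (small g 2) (single i 1 + z)%R
    (single (e (i + r - k)) 1 + single (e k) q.+1)%R.
  apply: (linked_trans zr); rewrite -(addn1 q) singleD [X in linked _ _ X]addrCA.
  by apply: pair_trade_high; lia.
have [lt|ge] := ltnP (i + r - k + q.+1 * k) a.
  by constructor 3; exists (i + r - k), q.+1; split=> //; lia.
have [||y ny y0] := @wrap_trade (i + r - k) q.+1; [lia|lia|].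
by constructor 1; exists y => //; exact: linked_trans zr' ny.
Qed.

(** The normal form has the least length for its weight, which is why all
factorizations of its value share its three invariants. *)
Lemma arith_normal_rigid r q z : 0 < r <= k -> r + q * k < a ->
  value g z = value g (single (e r) 1 + single (e k) q)%R ->
  [/\ z ord0 = 0, upper_length z = q.+1 & weight z = r + q * k].
Proof.
move=> rk rqa /esym zE.
have e0 i : 0 < i <= k -> (e i == ord0) = false.
  by case/andP=> i0 ik; rewrite -val_eqE /= inordK // gtn_eqF.
have eE i : 0 < i <= k -> e i = i :> nat by case/andP=> i0 ik; rewrite inordK.
have kk : 0 < k <= k by lia.
have x0 : (single (e r) 1 + single (e k) q)%R ord0 = 0.
  by rewrite addzE !singleE ![ord0 == _]eq_sym !e0.
have xl : upper_length (single (e r) 1 + single (e k) q)%R = q.+1.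
  by rewrite upper_lengthD !upper_length_single !e0.
have xw : weight (single (e r) 1 + single (e k) q)%R = r + q * k.
  by rewrite weightD !weight_single !eE // mul1n.
have := arith_rigid zE; rewrite x0 xl xw; apply=> //; lia.
Qed.

Lemma arith_gt0 i : 0 < g i.
Proof. exact: generator_gt0 arith_minimal. Qed.

Lemma arith_linked z z' : value g z = value g z' -> linked (small g 2) z z'.
Proof.
apply: (linked_by_descent (i0 := ord0)) => [t /smallP||{}z {}z' zz'] //.
have vE u v : linked (small g 2) u v -> value g u = value g v.
  by apply: linked_value => t /smallP.
(* A fiber cannot contain both a normal form and a factorization using a. *)
have clash u u' r q y : value g u = value g u' -> linked (small g 2) u y ->
    0 < y ord0 -> 0 < r <= k -> r + q * k < a ->
    linked (small g 2) u' (single (e r) 1 + single (e k) q)%R -> False.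
  move=> uu' uy y0 rk rqa u'r.
  have [] := @arith_normal_rigid r q y rk rqa; last by lia.
  by rewrite -(vE _ _ uy) uu' (vE _ _ u'r).
have zero u : value g u = value g 0%R -> u = 0%R.
  by rewrite value0; apply: value_eq0 => i; exact: arith_gt0.
case: (arith_normal_form z) => [[y zy y0]|z0|[r [q [rk rqa zr]]]].
- case: (arith_normal_form z') => [[y' zy' y0']|z0'|[r [q [rk rqa zr]]]].
  + by right; exists y, y'.
  + by left; rewrite z0' (zero z) ?zz' ?z0' //; exact: linked_refl.
  + by case: (clash _ _ _ _ _ zz' zy y0 rk rqa zr).
- by left; rewrite z0 (zero z') -?zz' ?z0 //; exact: linked_refl.
- left; case: (arith_normal_form z') => [[y' zy' y0']|z0'|[r' [q' [rk' rqa' zr']]]].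
  + by case: (clash _ _ _ _ _ (esym zz') zy' y0' rk rqa zr).
  + by rewrite z0' (zero z) ?zz' ?z0' //; exact: linked_refl.
  + have [_ l w] := arith_normal_rigid rk rqa (vE _ _ zr).
    have [_ l' w'] := arith_normal_rigid rk' rqa' (etrans zz' (vE _ _ zr')).
    have qq : q = q' by lia.
    have rr : r = r' by rewrite qq in w; lia.
    by apply: (linked_trans zr); rewrite qq rr; exact: linked_sym.
Qed.

(** The sum of all generators may have no other factorization.  With h copies of a
the trade h a + b_2 ~ 2 b_1 applies, while cancelling all generators but one
leaves h a or (h - 1) a + b_j, which [first_generator_needed] and
[later_generator_needed] still control. *)
Lemma arith_Delta0 : Delta0 (generated g) = [set 1; 2].
Proof.
pose w : factorization k.+1 := [ffun l => ((l != ord0) && (l != e 2) : nat)].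
pose z : factorization k.+1 := [ffun l => if l == ord0 then h else 1].
have wE l : w l = (l != ord0) && (l != e 2) by rewrite ffunE.
have zE l : z l = if l == ord0 then h else 1 by rewrite ffunE.
have e20 : (e 2 == ord0) = false by rewrite -val_eqE /= inordK.
have e10 : (e 1 == ord0) = false by rewrite -val_eqE /= inordK //; lia.
have zD : z = (w + (single ord0 h + single (e 2) 1))%R.
  apply: eqz => l; rewrite !addzE !singleE wE zE.
  by case: (eqVneq l ord0) => [->|_] /=; rewrite 1?eq_sym ?e20 ?addn0 //; case: eqP.
apply: (@Delta0_of_exchange2 _ _ g arith_minimal z (w + single (e 1) 2)%R ord0) => //.
- by lia.
- exact: arith_linked.
- by move=> l; rewrite zE; case: ifP.
- by rewrite zD !valueD !value_single !g_inord; [rewrite g_ord0; lia|lia|lia].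
- by rewrite addzE wE eqxx singleE [ord0 == _]eq_sym e10.
- move=> l v; have [->|l0] := eqVneq l ord0.
    have -> : [ffun s => z s - (s != ord0)] = single ord0 h.
      by apply: eqz => s; rewrite ffunE zE singleE; case: eqP => /=; lia.
    by rewrite value_single; apply: first_generator_needed; rewrite h_gt0 /=.
  have -> : [ffun s => z s - (s != l)] = (single ord0 h.-1 + single l 1)%R.
    apply: eqz => s; rewrite ffunE addzE !singleE zE.
    case: (eqVneq s ord0) => [->|_]; last by case: eqP.
    by rewrite ![ord0 == _]eq_sym (negPf l0) /=; lia.
  rewrite valueD !value_single mul1n; apply: later_generator_needed => //; lia.
Qed.

End ArithmeticSequence.

(** * Gaps in the three families of semigroups *)

Theorem theorem4p2 :
  (* (a) *)
  (forall (S : set nat) (k : nat) (a : 'I_k -> nat),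
     numerical_semigroup S -> 2 <= k -> minimal_generators S a ->
     (has_singleton_presentation a -> Delta0 S = [set 1]) /\
     (supersymmetric S \/ geometric S ->
        has_singleton_presentation a /\ Delta0 S = [set 1])) /\
  (* (b) *)
  (forall (S : set nat) (m : nat) (a : nat -> nat),
     numerical_semigroup S -> 3 <= m ->
     (forall i, 0 < i < m -> a i = i %[mod m]) ->
     S m -> (forall x, S x -> 0 < x -> m <= x) ->
     minimal_generators S (fun i : 'I_m => if i == 0 :> nat then m else a i) ->
     Delta0 S = [set 1; 2]) /\
  (* (c) *)
  (forall (S : set nat) (a d h k : nat),
     0 < a -> 0 < d -> 0 < h -> 2 <= k < a -> coprime a d ->
     S = generated (fun i : 'I_k.+1 => if i == 0 :> nat then a else a * h + i * d) ->
     Delta0 S = [set 1; 2]).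
Proof.
split; last split.
- move=> S k a _ k2 mga.
  have D1 : has_singleton_presentation a -> Delta0 S = [set 1].
    by move=> /singleton_presentation_linked; apply: Delta0_of_exchange1.
  split=> // special; suff sing : has_singleton_presentation a by split=> //; exact: D1.
  case: special; first exact: supersymmetric_singleton_presentation.
  exact: geometric_singleton_presentation.
- move=> S [|[|[|m]]] // a _ _ amod _ _ mg.
  apply: (med_Delta0 _ _ mg) => // i; have := ltn_ord i.
  case: eqP => [->|/eqP i0] lt; first by rewrite modnn mod0n.
  by apply: amod; rewrite lt lt0n i0.
- by move=> S a d h k a0 d0 h0 /andP[k2 ka] cop ->; apply: arith_Delta0.
Qed.
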